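(* Fix $n\geq 1$ and let $k\geq 3$ be an integer. If there exist positive definite matrices $A_1,\ldots,A_k\in\mathbb{C}^{n\times n}$ with $F(A_1,\ldots,A_k)<\frac{k}{2}n$, then there exist positive definite matrices $B_1,\ldots,B_{k+2}\in\mathbb{C}^{n\times n}$ with $F(B_1,\ldots,B_{k+2})<\frac{k+2}{2}n$. That is, if the inequality ''$F(A_1,\ldots,A_p)\geq \frac{p}{2}n$ for all positive definite $A_1,\ldots,A_p\in\mathbb{C}^{n\times n}$'' does not hold for $p=k$, then it does not hold for $p=k+2$.
   Context: A matrix $A\in\mathbb{C}^{n\times n}$ is called positive definite if it is Hermitian and $x^*Ax>0$ for all $0\neq x\in\mathbb{C}^n$. For any integer $p\geq 3$ and positive definite matrices $A_1,\ldots, A_p \in \mathbb{C}^{n \times n}$, define $$F(A_1, \ldots, A_p):=Tr\left[\sum_{i=1}^p A_i(A_{i+1}+A_{i+2})^{-1}\right],$$ where $A_{p+1}=A_1$, $A_{p+2}=A_2$, and $Tr$ denotes the trace (this quantity is real). *)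

(* Defs.v *)
From mathcomp Require Import all_boot all_order all_algebra.
From mathcomp Require Import sesquilinear spectral.
From mathcomp Require Import reals complex.

Set Implicit Arguments.
Unset Strict Implicit.
Unset Printing Implicit Defensive.

Import Order.TTheory GRing.Theory Num.Theory.
Local Open Scope ring_scope.
Local Open Scope sesquilinear_scope.

(* On R[i], [x < y] and [x <= y] compare real parts and force equal imaginary
   parts, so [0 < z] says that z is real and positive. *)
Definition posdefmx (R : realType) (n : nat) (A : 'M[R[i]]_n) : Prop :=
  A \is hermsymmx /\
  forall x : 'cV[R[i]]_n, x != 0 -> 0 < (x ^t* *m A *m x) 0 0.

(* Indices run over 0, ..., p-1, and [ordS] is the successor modulo p. *)
Definition shapiroF (R : realType) (n p : nat) (A : 'I_p -> 'M[R[i]]_n) :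
    R[i] :=
  \tr (\sum_(i < p) A i *m invmx (A (ordS i) + A (ordS (ordS i)))).

Definition shapiro_inequality (R : realType) (n p : nat) : Prop :=
  forall A : 'I_p -> 'M[R[i]]_n,
    (forall i, posdefmx (A i)) -> p%:R / 2%:R * n%:R <= shapiroF A.

(* Main.v *)
Require Import Defs.
From mathcomp Require Import all_boot all_order all_algebra.
From mathcomp Require Import sesquilinear spectral.
From mathcomp Require Import reals complex.

Set Implicit Arguments.
Unset Strict Implicit.
Unset Printing Implicit Defensive.

Import Order.TTheory GRing.Theory Num.Theory.
Local Open Scope ring_scope.

(** Append the first two matrices again: the cyclic sequence
    [A_1, ..., A_k, A_1, A_2] has the same first [k] summands as
    [A_1, ..., A_k], and its last two summands add up to
    [(A_1 + A_2) (A_1 + A_2)^-1 = I].  Hence [F] grows by exactly [n], as does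
    the bound [k n / 2]. *)

Lemma posdefmxD (R : realType) (n : nat) (A B : 'M[R[i]]_n) :
  posdefmx A -> posdefmx B -> posdefmx (A + B).
Proof.
move=> [hA pA] [hB pB]; split=> [|x x0].
  (* [hermsymmx] carries a sign [(-1) ^+ 0]; once it is erased, additivity of the conjugate
     transpose suffices. *)
  apply/is_hermitianmxP; rewrite !expr0 !scale1r linearD /= map_mxD.
  move/is_hermitianmxP: hA; move/is_hermitianmxP: hB.
  by rewrite !expr0 !scale1r => <- <-.
by rewrite mulmxDr mulmxDl mxE addr_gt0 ?pA ?pB.
Qed.

(** A nonzero row [v] with [v *m A = 0] would make the quadratic form vanish at the nonzero column
    [x = v^*], since [x^* A x = v A x]. *)
Lemma posdefmx_unit (R : realType) (n : nat) (A : 'M[R[i]]_n) :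
  posdefmx A -> A \in unitmx.
Proof.
move=> [_ pA]; rewrite -row_free_unit -kermx_eq0.
apply/negPn/negP => /rowV0Pn [v /sub_kermxP vA v0].
have vE : ((v ^t Num.conj) ^t Num.conj)%sesqui = v.
  by apply/matrixP => i j; rewrite !mxE conjCK.
have /pA : (v ^t Num.conj)%sesqui != 0.
  by apply: contra_neq v0 => w0; rewrite -vE w0; apply/matrixP => i j;
     rewrite !mxE conjC0.
by rewrite vE vA mul0mx mxE ltxx.
Qed.

Definition ord_mod (k : nat) (k_gt0 : (0 < k)%N) (m : nat) : 'I_k :=
  Ordinal (ltn_pmod m k_gt0).

(** Reduction mod [k] sends the two new indices [k] and [k.+1] to 0 and 1. *)
Definition cyclic_extension (T : Type) (k : nat) (k_gt0 : (0 < k)%N)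
    (A : 'I_k -> T) (i : 'I_k.+2) : T :=
  A (ord_mod k_gt0 i).

Lemma shapiroF_cyclic_extension (R : realType) (n k : nat) (k_gt0 : (0 < k)%N)
    (A : 'I_k -> 'M[R[i]]_n) :
  (1 < k)%N -> (forall i, posdefmx (A i)) ->
  shapiroF (cyclic_extension k_gt0 A) = shapiroF A + n%:R.
Proof.
move=> k_gt1 pA; rewrite /shapiroF !big_ord_recr /= -addrA mxtraceD.
congr (_ + _).
  (* For [i < k] the successors [i.+1] and [i.+2] do not wrap mod [k.+2], so reducing them mod [k]
     gives the successors in ['I_k]. *)
  congr (\tr _); apply: eq_bigr => i _; have i2 : (i.+2 < k.+2)%N := ltn_ord i.
  have i1 : (i.+1 < k.+2)%N := ltnW i2.
  rewrite /cyclic_extension.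
  congr (A _ *m invmx (A _ + A _)); apply/val_inj => /=.
  - by rewrite modn_small.
  - by rewrite (modn_small i1).
  - by rewrite (modn_small i1) (modn_small i2) -[in RHS]addn1 modnDml addn1.
set a := A (ord_mod k_gt0 0); set b := A (ord_mod k_gt0 1).
have extE (j : 'I_k.+2) m :
    j = m %[mod k] -> cyclic_extension k_gt0 A j = A (ord_mod k_gt0 m).
  by move=> jm; congr A; apply/val_inj.
have kS : k.+1 = 1 %[mod k] by rewrite -addn1 modnDl.
(* Positions [k], [k.+1], 0, 1 carry [a], [b], [a], [b]: the last two summands are [a (b + a)^-1]
   and [b (a + b)^-1]. *)
rewrite (extE _ 0%N) /=; last by rewrite modnn mod0n.
rewrite (extE _ 1%N) /=; last by rewrite (@modn_small k.+1).
rewrite (extE _ 0%N) /=; last by rewrite (@modn_small k.+1) // modnn.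
rewrite (extE _ 1%N) //= (extE _ 0%N) /=; last by rewrite modnn.
rewrite (extE _ 1%N) /=; last by rewrite modnn modn_small.
rewrite -/a -/b (addrC b) -mulmxDl mulmxV ?mxtrace1 //.
by apply: posdefmx_unit; apply: posdefmxD; apply: pA.
Qed.

Lemma shapiro_boundSS (R : realType) (n k : nat) :
  k.+2%:R / 2%:R * n%:R = k%:R / 2%:R * n%:R + n%:R :> R[i].
Proof.
by rewrite -addn2 natrD mulrDl divff ?pnatr_eq0 // mulrDl mul1r.
Qed.

Theorem proposition2p8 (R : realType) (n k : nat) (hn : (1 <= n)%N)
    (hk : (3 <= k)%N) :
  ((exists A : 'I_k -> 'M[R[i]]_n,
      (forall i, posdefmx (A i)) /\ shapiroF A < k%:R / 2%:R * n%:R) ->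
   exists B : 'I_k.+2 -> 'M[R[i]]_n,
      (forall i, posdefmx (B i)) /\ shapiroF B < k.+2%:R / 2%:R * n%:R)
  /\ (~ shapiro_inequality R n k -> ~ shapiro_inequality R n k.+2).
Proof.
have k_gt1 : (1 < k)%N := ltnW hk.
have k_gt0 : (0 < k)%N := ltnW k_gt1.
split=> [[A [pA FA]]|nk kSS].
  exists (cyclic_extension k_gt0 A); split=> [i|]; first exact: pA.
  by rewrite shapiroF_cyclic_extension // shapiro_boundSS ltrD2r.
(* The order on [R[i]] is partial, so a failed [<=] is not at once a strict [<]. The contrapositive
   avoids this: the bound for [k.+2], applied to the extension, gives the bound for [k] after
   cancelling [n]. *)
apply: nk => A pA.
have := kSS (cyclic_extension k_gt0 A) (fun i => pA _).
by rewrite shapiroF_cyclic_extension // shapiro_boundSS lerD2r.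
Qed.
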